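(* Let $E,A\in\mathbb{R}^{\ell\times n}$, $B\in\mathbb{R}^{\ell\times m}$, and let $\mathcal{V}^*:=\mathcal{V}^*_{[E,A,B]}$, $\mathcal{W}^*:=\mathcal{W}^*_{[E,A,B]}$ be the augmented Wong limits of $[E,A,B]$. Choose full column rank matrices $U_T\in\mathbb{R}^{n\times n_1}$, $R_T\in\mathbb{R}^{n\times n_2}$, $O_T\in\mathbb{R}^{n\times n_3}$, $Q_S\in\mathbb{R}^{\ell\times m_2}$, $U_S\in\mathbb{R}^{\ell\times \ell_1}$, $R_S\in\mathbb{R}^{\ell\times \ell_2}$, $O_S\in\mathbb{R}^{\ell\times \ell_3}$ such that $$\operatorname{im} U_T=\mathcal{V}^*\cap\mathcal{W}^*,\qquad \operatorname{im} R_T\oplus\operatorname{im} U_T=\mathcal{V}^*,\qquad \operatorname{im} O_T\oplus\operatorname{im} R_T\oplus\operatorname{im} U_T=\mathbb{R}^n,$$ $$\operatorname{im} Q_S=\operatorname{im} B,\qquad \operatorname{im} U_S\oplus\operatorname{im} Q_S=E(\mathcal{V}^*\cap\mathcal{W}^* )+\operatorname{im} B,$$ $$\operatorname{im} R_S\oplus\operatorname{im} U_S\oplus\operatorname{im} Q_S=E\mathcal{V}^*+\operatorname{im} B,\qquad \operatorname{im} O_S\oplus\operatorname{im} R_S\oplus\operatorname{im} U_S\oplus\operatorname{im} Q_S=\mathbb{R}^\ell.$$ Let $T:=[U_T,R_T,O_T]$, $S:=[U_S,R_S,O_S,Q_S]^{-1}$, choose (not necessarily full rank) matrices $F_P,F_D\in\mathbb{R}^{m\times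 n}$ such that $$0=[0,I_{m_2}]\,S\,(ET+BF_D),\qquad 0=[0,I_{m_2}]\,S\,(AT+BF_P),$$ and choose $V=[V_1,V_2]$ with full column rank matrices $V_1\in\mathbb{R}^{m\times m_1}$, $V_2\in\mathbb{R}^{m\times m_2}$ such that $$\operatorname{im} V_1=\ker B,\qquad \operatorname{im} V_1\oplus\operatorname{im} V_2=\mathbb{R}^m.$$ Then $[S(ET+BF_D),\;S(AT+BF_P),\;SBV]$ is in quasi PD-feedback form (QPDFF), with block sizes $\ell_1,\ell_2,\ell_3$; $n_1,n_2,n_3$; $m_1,m_2$.
   Context: $\Sigma_{\ell,n,m}$ is the set of triples $[E,A,B]$ with $E,A\in\mathbb{R}^{\ell\times n}$, $B\in\mathbb{R}^{\ell\times m}$. Augmented Wong sequences: for $[E,A,B]\in\Sigma_{\ell,n,m}$ put $\mathcal{V}^0_{[E,A,B]}:=\mathbb{R}^n$, $\mathcal{V}^{i+1}_{[E,A,B]}:=A^{-1}(E\mathcal{V}^i_{[E,A,B]}+\operatorname{im} B)$ and $\mathcal{W}^0_{[E,A,B]}:=\{0\}$, $\mathcal{W}^{i+1}_{[E,A,B]}:=E^{-1}(A\mathcal{W}^i_{[E,A,B]}+\operatorname{im} B)$, where $A^{-1}(\cdot)$, $E^{-1}(\cdot)$ denote preimages of subspaces under the linear maps $A,E:\mathbb{R}^n\to\mathbb{R}^\ell$. The augmented Wong limits are $\mathcal{V}^*_{[E,A,B]}:=\bigcap_{i\ge 0}\mathcal{V}^i_{[E,A,B]}$ and $\mathcal{W}^*_{[E,A,B]}:=\bigcup_{i\ge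 0}\mathcal{W}^i_{[E,A,B]}$ (both are linear subspaces of $\mathbb{R}^n$). Quasi PD-feedback form (QPDFF): a triple $[E,A,B]\in\Sigma_{\ell,n,m}$ is in QPDFF if $$E=\begin{bmatrix}E_{11}&E_{12}&E_{13}\\0&E_{22}&E_{23}\\0&0&E_{33}\\0&0&0\end{bmatrix},\quad A=\begin{bmatrix}A_{11}&A_{12}&A_{13}\\0&A_{22}&A_{23}\\0&0&A_{33}\\0&0&0\end{bmatrix},\quad B=\begin{bmatrix}0&0\\0&0\\0&0\\0&\hat B\end{bmatrix}$$ with row block sizes $\ell_1,\ell_2,\ell_3,m_2$, column block sizes $n_1,n_2,n_3$ (for $E,A$) and $m_1,m_2$ (for $B$), where (i) $E_{11},A_{11}\in\mathbb{R}^{\ell_1\times n_1}$ with $\ell_1<n_1$ and $\operatorname{rk}E_{11}=\operatorname{rk}_{\mathbb{C}}(\lambda E_{11}-A_{11})=\ell_1$ for all $\lambda\in\mathbb{C}$; (ii) $E_{22},A_{22}\in\mathbb{R}^{\ell_2\times n_2}$ with $\ell_2=n_2$ and $E_{22}$ invertible; (iii) $E_{33},A_{33}\in\mathbb{R}^{\ell_3\times n_3}$ with $\operatorname{rk}_{\mathbb{C}}(\lambda E_{33}-A_{33})=n_3$ for all $\lambda\in\mathbb{C}$; (iv) $\hat B\in\mathbb{R}^{m_2\times m_2}$ is invertible, where $m_2=\operatorname{rk}B$. The remaining matrices have suitable sizes. Blocks may be empty (any of the sizes may be $0$); if the first block is void, i.e. $\ell_1=n_1=0$, the strict inequality $\ell_1<n_1$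 is not required. *)

(* Defs.v *)
From HB Require Import structures.
From mathcomp Require Import all_boot all_order all_algebra.
From mathcomp Require Import boolp reals.
From mathcomp Require Export complex.
Set Implicit Arguments.
Unset Strict Implicit.
Unset Printing Implicit Defensive.
Import Order.TTheory GRing.Theory Num.Theory.
Local Open Scope ring_scope.

(* A p x q matrix acts on column vectors, x |-> M *m x.  (The subspaces of
   mxalgebra are row spaces, hence the use of {vspace 'cV_q} instead.) *)
Definition mxfun (F : fieldType) (p q : nat) (M : 'M[F]_(p, q)) :
  'Hom('cV[F]_q, 'cV[F]_p) := linfun (mulmx M).

Definition im (F : fieldType) (p q : nat) (M : 'M[F]_(p, q)) :
  {vspace 'cV[F]_p} := limg (mxfun M).

Definition ker (F : fieldType) (p q : nat) (M : 'M[F]_(p, q)) :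
  {vspace 'cV[F]_q} := lker (mxfun M).

Lemma mxfunE (F : fieldType) (p q : nat) (M : 'M[F]_(p, q)) x :
  mxfun M x = M *m x.
Proof. by rewrite lfunE. Qed.

Section WongSequences.
Variables (F : fieldType) (l n m : nat).
Variables (E A : 'M[F]_(l, n)) (B : 'M[F]_(l, m)).

Fixpoint wongV (i : nat) : {vspace 'cV[F]_n} :=
  if i is j.+1 then (mxfun A @^-1: (mxfun E @: wongV j + im B))%VS
  else fullv.

Fixpoint wongW (i : nat) : {vspace 'cV[F]_n} :=
  if i is j.+1 then (mxfun E @^-1: (mxfun A @: wongW j + im B))%VS
  else 0%VS.

Lemma wongW_incr i : (wongW i <= wongW i.+1)%VS.
Proof.
elim: i => [|i IHi]; first exact: sub0v.
apply/subvP => x; rewrite -!memv_preim.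
by apply/subvP; rewrite addvS ?limgS.
Qed.

End WongSequences.

(* The intersection of a sequence of subspaces, and the union of a
   nondecreasing one, are subspaces. *)
Section SeqLimits.
Variables (F : fieldType) (vT : vectType F) (U : nat -> {vspace vT}).

Lemma capv_seq_subproof :
  exists V : {vspace vT}, forall x, (x \in V) <-> (forall i, x \in U i).
Proof.
pose C N := (\bigcap_(i < N) U i)%VS.
have CP N x : reflect (forall i, (i < N)%N -> x \in U i) (x \in C N).
  apply: (iffP subv_bigcapP) => [h i ltiN|h i _]; first exact: (h (Ordinal ltiN)).
  by apply: h; exact: ltn_ord.
have exC : exists d, `[< exists N, \dim (C N) = d >].
  by exists (\dim (C 0%N)); apply/asboolP; exists 0%N.
case: (ex_minnP exC) => d /asboolP[N dimN] min_d.
exists (C N) => x; split => [xN i|h]; last by apply/CP => i _; exact: h.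
pose M := maxn N i.+1.
have subMN : (C M <= C N)%VS.
  apply/subvP => y /CP hy; apply/CP => j ltjN; apply: hy.
  by rewrite leq_max ltjN.
have : C M == C N.
  by rewrite eqEdim subMN dimN min_d //; apply/asboolP; exists M.
move=> /eqP eqMN; move: xN; rewrite -eqMN => /CP; apply.
by rewrite leq_max leqnn orbT.
Qed.

Lemma cupv_seq_subproof : (forall i, (U i <= U i.+1)%VS) ->
  exists V : {vspace vT}, forall x, (x \in V) <-> (exists i, x \in U i).
Proof.
move=> incU.
have leU i j : (i <= j)%N -> (U i <= U j)%VS.
  elim: j => [|j IHj]; first by rewrite leqn0 => /eqP->.
  rewrite leq_eqVlt => /orP[/eqP->//|/IHj h].
  exact: subv_trans h (incU j).
have exU : exists d, `[< exists N, \dim (U N) = d >].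
  by exists (\dim (U 0%N)); apply/asboolP; exists 0%N.
have bU d : `[< exists N, \dim (U N) = d >] -> (d <= \dim {:vT})%N.
  by move=> /asboolP[N <-]; apply/dimvS/subvf.
case: (ex_maxnP exU bU) => d /asboolP[N dimN] max_d.
exists (U N) => x; split => [xN|[i xi]]; first by exists N.
have subN : (U N <= U (maxn N i))%VS by rewrite leU ?leq_maxl.
have /eqP-> : U N == U (maxn N i).
  by rewrite eqEdim subN dimN max_d //; apply/asboolP; exists (maxn N i).
by apply: subvP xi; rewrite leU ?leq_maxr.
Qed.

End SeqLimits.

Section WongLimits.
Variables (F : fieldType) (l n m : nat).
Variables (E A : 'M[F]_(l, n)) (B : 'M[F]_(l, m)).

Definition wongVlim : {vspace 'cV[F]_n} :=
  sval (cid (capv_seq_subproof (wongV E A B))).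

Definition wongWlim : {vspace 'cV[F]_n} :=
  sval (cid (cupv_seq_subproof (wongW_incr E A B))).

Lemma mem_wongVlim x : (x \in wongVlim) <-> (forall i, x \in wongV E A B i).
Proof. exact: (svalP (cid (capv_seq_subproof (wongV E A B)))). Qed.

Lemma mem_wongWlim x : (x \in wongWlim) <-> (exists i, x \in wongW E A B i).
Proof. exact: (svalP (cid (cupv_seq_subproof (wongW_incr E A B)))). Qed.

End WongLimits.

Section QPDFF.
Variables (R : realType).

Definition pencilC (p q : nat) (E A : 'M[R]_(p, q)) (lambda : R[i]) :
  'M[R[i]]_(p, q) :=
  lambda *: map_mx (real_complex R) E - map_mx (real_complex R) A.

Definition qpdff (l1 l2 l3 n1 n2 n3 m1 m2 : nat)
    (E A : 'M[R]_(l1 + l2 + l3 + m2, n1 + n2 + n3))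
    (B : 'M[R]_(l1 + l2 + l3 + m2, m1 + m2)) : Prop :=
  exists (E11 A11 : 'M[R]_(l1, n1)) (E12 A12 : 'M[R]_(l1, n2))
         (E13 A13 : 'M[R]_(l1, n3)) (E22 A22 : 'M[R]_(l2, n2))
         (E23 A23 : 'M[R]_(l2, n3)) (E33 A33 : 'M[R]_(l3, n3))
         (Bhat : 'M[R]_m2),
  [/\ [/\ E = col_mx (col_mx (col_mx
                (row_mx (row_mx E11 E12) E13)
                (row_mx (row_mx 0   E22) E23))
                (row_mx (row_mx 0   0)   E33))
                0,
          A = col_mx (col_mx (col_mx
                (row_mx (row_mx A11 A12) A13)
                (row_mx (row_mx 0   A22) A23))
                (row_mx (row_mx 0   0)   A33))
                0
        & B = col_mx (col_mx (col_mx
                (row_mx 0 0)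
                (row_mx 0 0))
                (row_mx 0 0))
                (row_mx 0 Bhat)],
      [/\ (l1 < n1)%N \/ (l1 = 0%N /\ n1 = 0%N),
          \rank E11 = l1
        & forall lambda : R[i], \rank (pencilC E11 A11 lambda) = l1],
      exists eq22 : l2 = n2, castmx (eq22, erefl n2) E22 \in unitmx,
      forall lambda : R[i], \rank (pencilC E33 A33 lambda) = n3
    & Bhat \in unitmx /\ m2 = \rank B].

End QPDFF.

(* Main.v *)
Require Import Defs.
From HB Require Import structures.
From mathcomp Require Import all_boot all_order all_algebra.
From mathcomp Require Import boolp reals.
From mathcomp Require Import ring.
Import Order.TTheory GRing.Theory Num.Theory.
Local Open Scope ring_scope.

(** Modulo [im B] the augmented Wong sequences are the ordinary ones of the
    pencil [lambda E - A].  With [K = V* :&: W*], stationarity gives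
    [V* = A^-1 (E V* + im B)], whence [A V* <= E V* + im B] and
    [A K <= E K + im B]: both matrices become block upper triangular along
    [K <= V* <= R^n] and [im B <= E K + im B <= E V* + im B <= R^l].
    For [x] in [V* :&: W_(i+1)] one has [E x = A w + B u] with [w] in
    [V* :&: W_i].  By induction on [i], a left null vector of
    [lambda E11 - A11] kills [E11], and [E11] can be injective only if [K = 0].
    [E22] is injective since [E x] in [E K + im B] with [x] in [V*] forces
    [x] in [K].  A right null vector of [lambda E33 - A33] would enlarge [V*],
    the largest [X] with [A X <= E X + im B]. *)

(** * Column images, kernels and ranks *)

Section ColumnMaps.
Set Implicit Arguments.
Unset Strict Implicit.
Variable F : fieldType.

Lemma imP p q (M : 'M[F]_(p, q)) x : reflect (exists y, x = M *m y) (x \in im M).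
Proof.
apply: (iffP memv_imgP) => [[y _ ->]|[y ->]].
  by exists y; rewrite mxfunE.
by exists y; rewrite ?memvf ?mxfunE.
Qed.

Lemma mem_im p q (M : 'M[F]_(p, q)) y : M *m y \in im M.
Proof. by apply/imP; exists y. Qed.

Lemma kerP p q (M : 'M[F]_(p, q)) x : reflect (M *m x = 0) (x \in ker M).
Proof. by rewrite memv_ker mxfunE; apply: eqP. Qed.

Lemma im_row_mx p q r (M : 'M[F]_(p, q)) (N : 'M[F]_(p, r)) :
  im (row_mx M N) = (im M + im N)%VS.
Proof.
apply/vspaceP => x; apply/imP/memv_addP => [[y ->]|].
  rewrite -[y]vsubmxK mul_row_col.
  by exists (M *m usubmx y); [|exists (N *m dsubmx y)]; rewrite ?mem_im.
case=> u /imP[a ->] [v /imP[b ->] ->].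
by exists (col_mx a b); rewrite mul_row_col.
Qed.

(** [X] is assembled column by column from chosen preimages of the columns of [M]. *)
Lemma im_factor p q r (M : 'M[F]_(p, q)) (N : 'M[F]_(p, r)) :
  (forall x, M *m x \in im N) -> exists X, M = N *m X.
Proof.
move=> MN; have /fin_all_exists[x xP] j : exists y, col j M = N *m y.
  by apply/imP; rewrite colE.
exists (\matrix_(i, j) x j i 0); apply/matrixP => i j.
have /colP/(_ i) := xP j; rewrite !mxE => ->.
by apply: eq_bigr => k _; rewrite !mxE.
Qed.

Lemma rank_mul_inj p q (M : 'M[F]_(p, q)) (x : 'cV_q) :
  \rank M = q -> M *m x = 0 -> x = 0.
Proof.
move=> rM Mx0; have fM : row_full M by rewrite /row_full rM.
by rewrite -[x]mul1mx -(mulVpmx fM) -mulmxA Mx0 mulmx0.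
Qed.

Lemma mul_inj_rank p q (M : 'M[F]_(p, q)) :
  (forall x : 'cV_q, M *m x = 0 -> x = 0) -> \rank M = q.
Proof.
move=> injM; rewrite -mxrank_tr; apply/eqP/inj_row_free => v /(congr1 trmx).
rewrite trmx_mul trmxK trmx0 => /injM /(congr1 trmx).
by rewrite trmxK trmx0.
Qed.

Lemma mul_surj_rank p q (M : 'M[F]_(p, q)) :
  (forall y, exists x : 'cV_q, y = M *m x) -> \rank M = p.
Proof.
move=> surjM; apply/eqP/inj_row_free => v vM0.
apply/rowP => j; have [x xP] := surjM (delta_mx j 0).
have /matrixP/(_ 0 0) : v *m delta_mx j 0 = 0 :> 'cV_1 by rewrite xP mulmxA vM0 mul0mx.
by rewrite -colE !mxE.
Qed.

Lemma mulmx_cV_eq0 p q (M : 'M[F]_(p, q)) : (forall x : 'cV_q, M *m x = 0) -> M = 0.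
Proof.
move=> M0; apply/matrixP => i j.
by have /colP/(_ i) := M0 (delta_mx j 0); rewrite -colE !mxE.
Qed.

(** Serves condition (ii) of the QPDFF, where the two sizes agree by a proof, hence the cast. *)
Lemma rank_castmx_unit p q (M : 'M[F]_(p, q)) :
  \rank M = p -> \rank M = q ->
  exists e : p = q, castmx (e, erefl q) M \in unitmx.
Proof.
move=> rp rq; have e : p = q by rewrite -rp.
exists e; case: q / e M rp {rq} => M rp.
by rewrite castmx_id -row_free_unit /row_free rp.
Qed.

Lemma capv0_add_eq0 (vT : vectType F) (U V : {vspace vT}) u v :
  (U :&: V)%VS == 0%VS -> u + v = 0 -> u \in U -> v \in V -> u = 0 /\ v = 0.
Proof.
move=> /eqP UV0 uv0 uU vV; have u0 : u = 0.
  apply/eqP; rewrite -memv0 -UV0 memv_cap uU.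
  by rewrite -(addrK v u) uv0 add0r memvN.
by split=> //; move: uv0; rewrite u0 add0r.
Qed.

End ColumnMaps.

(** * Stationarity, invariance and maximality of the augmented Wong limits *)

Section WongLimitTheory.
Set Implicit Arguments.
Unset Strict Implicit.
Variables (F : fieldType) (l n m : nat).
Variables (E A : 'M[F]_(l, n)) (B : 'M[F]_(l, m)).
Let Vs := wongVlim E A B.
Let Ws := wongWlim E A B.

Lemma mem_img_add_im (N : 'M[F]_(l, n)) (X : {vspace 'cV[F]_n}) y :
  reflect (exists2 v, v \in X & exists u, y = N *m v + B *m u)
          (y \in (mxfun N @: X + im B)%VS).
Proof.
apply: (iffP memv_addP) => [[_ /memv_imgP[v vX ->]] [_ /imP[u ->] ->]|[v vX [u ->]]].
  by exists v => //; exists u; rewrite mxfunE.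
exists (N *m v); first by rewrite -mxfunE memv_img.
by exists (B *m u); rewrite ?mem_im.
Qed.

Lemma mem_preim_img (M N : 'M[F]_(l, n)) (X : {vspace 'cV[F]_n}) x :
  reflect (exists2 v, v \in X & exists u, M *m x = N *m v + B *m u)
          (x \in (mxfun M @^-1: (mxfun N @: X + im B))%VS).
Proof. by rewrite -memv_preim mxfunE; apply: mem_img_add_im. Qed.

Lemma wongV_decr i : (wongV E A B i.+1 <= wongV E A B i)%VS.
Proof.
elim: i => [|i IHi]; first exact: subvf.
apply/subvP => x /mem_preim_img[v vV eqx]; apply/mem_preim_img.
by exists v => //; apply: subvP vV.
Qed.

(** If no two consecutive terms agreed, each step would lose a dimension of a finite-dimensional
    space. *)
Lemma wongV_stationary : exists N, wongV E A B N.+1 = wongV E A B N.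
Proof.
apply: contrapT => /forallNP neqV.
have dimV k : (\dim (wongV E A B k) + k <= \dim (wongV E A B 0))%N.
  elim: k => [|k IHk]; first by rewrite addn0.
  apply: leq_trans IHk; rewrite addnS ltn_add2r.
  rewrite ltnNge; apply: contra_notN (neqV k) => dimk.
  by apply/eqP; rewrite eqEdim wongV_decr.
by have := dimV (\dim (wongV E A B 0)).+1; rewrite addnS ltnNge leq_addl.
Qed.

Lemma wongVlim_stationary :
  exists2 N, Vs = wongV E A B N & wongV E A B N.+1 = wongV E A B N.
Proof.
have [N eqN] := wongV_stationary; exists N => //.
have VN k : wongV E A B (N + k) = wongV E A B N.
  by elim: k => [|k IHk]; rewrite ?addn0 // addnS [LHS]/= IHk.
have decr i j : (i <= j)%N -> (wongV E A B j <= wongV E A B i)%VS.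
  elim: j => [|j IHj]; first by rewrite leqn0 => /eqP->.
  rewrite leq_eqVlt => /orP[/eqP->//|/IHj]; exact/subv_trans/wongV_decr.
apply/vspaceP => x; apply/idP/idP => [/mem_wongVlim/(_ N)//|xN].
apply/mem_wongVlim => i; case: (leqP i N) => [/decr/subvP-> //|/ltnW leNi].
by rewrite -(subnKC leNi) VN.
Qed.

Lemma wongVlimE : Vs = (mxfun A @^-1: (mxfun E @: Vs + im B))%VS.
Proof. by have [N -> eqN] := wongVlim_stationary; rewrite -[LHS]eqN. Qed.

Lemma wongVlimP x :
  reflect (exists2 v, v \in Vs & exists u, A *m x = E *m v + B *m u) (x \in Vs).
Proof. by rewrite [in X in reflect _ X]wongVlimE; apply: mem_preim_img. Qed.

Lemma wongVlim_max (X : {vspace 'cV[F]_n}) :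
  (forall x, x \in X -> exists2 v, v \in X & exists u, A *m x = E *m v + B *m u) ->
  (X <= Vs)%VS.
Proof.
move=> invX; suff XV i : (X <= wongV E A B i)%VS.
  by apply/subvP => x xX; apply/mem_wongVlim => i; apply: subvP xX.
elim: i => [|i IHi]; first exact: subvf.
apply/subvP => x /invX[v vX eqx]; apply/mem_preim_img.
by exists v => //; apply: subvP vX.
Qed.

(** Solved for [A *m w], the equation reads [A w = E x - B u] with [x] in [Vs], so the fixed-point
    equation puts [w] in [Vs]. *)
Lemma wongW_step i x : x \in Vs -> x \in wongW E A B i.+1 ->
  exists2 w, w \in (Vs :&: wongW E A B i)%VS & exists u, E *m x = A *m w + B *m u.
Proof.
move=> xV /mem_preim_img[w wW [u eqx]]; exists w; last by exists u.
rewrite memv_cap wW andbT; apply/wongVlimP; exists x => //; exists (- u).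
by rewrite eqx mulmxN addrK.
Qed.

Lemma wongW_mem_cap i x : x \in Vs -> x \in wongW E A B i -> x \in (Vs :&: Ws)%VS.
Proof. by move=> xV xW; rewrite memv_cap xV; apply/mem_wongWlim; exists i. Qed.

(** Read backwards, [A x = E v + B u] places [v] one level above [x] in the sequence [wongW]. *)
Lemma wong_cap_inv x : x \in (Vs :&: Ws)%VS ->
  exists2 v, v \in (Vs :&: Ws)%VS & exists u, A *m x = E *m v + B *m u.
Proof.
rewrite memv_cap => /andP[/wongVlimP[v vV [u eqx]] /mem_wongWlim[i xW]].
exists v; last by exists u.
apply: (@wongW_mem_cap i.+1) => //; apply/mem_preim_img; exists x => //.
by exists (- u); rewrite eqx mulmxN addrK.
Qed.

(** [E (x - v)] lies in [im B], so [x - v] is already in [wongW E A B 1]. *)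
Lemma wong_cap_mod x v u : x \in Vs -> v \in (Vs :&: Ws)%VS ->
  E *m x = E *m v + B *m u -> x \in (Vs :&: Ws)%VS.
Proof.
move=> xV vK eqx; rewrite -[x](subrK v) memvD //.
apply: (@wongW_mem_cap 1); first by rewrite memvB //; case/memv_capP: vK.
apply/mem_preim_img; exists 0; rewrite ?mem0v //; exists u.
by rewrite mulmx0 add0r mulmxBr eqx addrC addKr.
Qed.

End WongLimitTheory.

(** * Block triangular form and its diagonal blocks *)

Section TriangularBlocks.
Set Implicit Arguments.
Unset Strict Implicit.
Variables (F : fieldType) (l n m n1 n2 n3 l1 l2 l3 m2 : nat).
Variables (E A : 'M[F]_(l, n)) (B : 'M[F]_(l, m)).
Variables (U_T : 'M[F]_(n, n1)) (R_T : 'M[F]_(n, n2)) (O_T : 'M[F]_(n, n3)).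
Variables (Q_S : 'M[F]_(l, m2)) (U_S : 'M[F]_(l, l1)) (R_S : 'M[F]_(l, l2)).
Variable (O_S : 'M[F]_(l, l3)).
Let Vs := wongVlim E A B.
Let Ws := wongWlim E A B.
Let M := row_mx (row_mx (row_mx U_S R_S) O_S) Q_S.

Hypothesis injT : forall a b c,
  U_T *m a + R_T *m b + O_T *m c = 0 :> 'cV_n -> [/\ a = 0, b = 0 & c = 0].
Hypothesis injS : forall x : 'cV_(l1 + l2 + l3 + m2), M *m x = 0 -> x = 0.
Hypothesis im_U_T : im U_T = (Vs :&: Ws)%VS.
Hypothesis im_R_T : (im R_T + im U_T)%VS = Vs.
Hypothesis im_Q_S : im Q_S = im B.
Hypothesis im_U_S : (im U_S + im Q_S)%VS = (mxfun E @: (Vs :&: Ws) + im B)%VS.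
Hypothesis im_R_S : (im R_S + im U_S + im Q_S)%VS = (mxfun E @: Vs + im B)%VS.
Hypothesis im_O_S : (im O_S + im R_S + im U_S + im Q_S)%VS = fullv.

Let U_T_K a : U_T *m a \in (Vs :&: Ws)%VS.
Proof. by rewrite -im_U_T mem_im. Qed.

Let U_T_V a : U_T *m a \in Vs.
Proof. by have /memv_capP[] := U_T_K a. Qed.

Let V_P x : reflect (exists a b, x = U_T *m a + R_T *m b) (x \in Vs).
Proof.
rewrite -im_R_T; apply: (iffP memv_addP) => [[_ /imP[b ->] [_ /imP[a ->] ->]]|].
  by exists a, b; rewrite addrC.
case=> a [b ->]; exists (R_T *m b); rewrite ?mem_im //.
by exists (U_T *m a); rewrite ?mem_im // addrC.
Qed.

(* [N *m [U_T, R_T, O_T]] is block upper triangular in the basis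
   [[U_S, R_S, O_S]] of a complement of [im B], modulo [im B]. *)
Definition triangular_mod (N : 'M[F]_(l, n))
    (N11 : 'M_(l1, n1)) (N12 : 'M_(l1, n2)) (N13 : 'M_(l1, n3))
    (N22 : 'M_(l2, n2)) (N23 : 'M_(l2, n3)) (N33 : 'M_(l3, n3)) : Prop :=
  forall a b c, exists u,
    N *m (U_T *m a + R_T *m b + O_T *m c) =
    U_S *m (N11 *m a + N12 *m b + N13 *m c) + R_S *m (N22 *m b + N23 *m c)
      + O_S *m (N33 *m c) + B *m u :> 'cV_l.

Lemma triangular_mod_exists (N : 'M[F]_(l, n)) :
  (forall a, N *m (U_T *m a) \in (im U_S + im Q_S)%VS) ->
  (forall b, N *m (R_T *m b) \in (im R_S + im U_S + im Q_S)%VS) ->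
  exists N11 N12 N13 N22 N23 N33, triangular_mod N N11 N12 N13 N22 N23 N33.
Proof.
move=> NU NR.
have [X1 eqX1] : exists X, N *m U_T = row_mx U_S Q_S *m X.
  by apply: im_factor => a; rewrite im_row_mx -mulmxA.
have [X2 eqX2] : exists X, N *m R_T = row_mx (row_mx R_S U_S) Q_S *m X.
  by apply: im_factor => a; rewrite !im_row_mx -mulmxA.
have [X3 eqX3] : exists X,
    N *m O_T = row_mx (row_mx (row_mx O_S R_S) U_S) Q_S *m X.
  by apply: im_factor => a; rewrite !im_row_mx im_O_S memvf.
move: eqX1 eqX2 eqX3.
rewrite -[X1]vsubmxK -[X2]vsubmxK -[usubmx X2]vsubmxK -[X3]vsubmxK.
rewrite -[usubmx X3]vsubmxK -[usubmx (usubmx X3)]vsubmxK !mul_row_col.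
set N11 := usubmx X1; set N12 := dsubmx (usubmx X2); set N22 := usubmx (usubmx X2).
set N33 := usubmx (usubmx (usubmx X3)); set N23 := dsubmx (usubmx (usubmx X3)).
set N13 := dsubmx (usubmx X3) => eqX1 eqX2 eqX3.
exists N11, N12, N13, N22, N23, N33 => a b c.
(* The coordinates along [Q_S] are absorbed in the term [B *m u]. *)
have /imP[u Bu] : Q_S *m (dsubmx X1 *m a + dsubmx X2 *m b + dsubmx X3 *m c) \in im B.
  by rewrite -im_Q_S mem_im.
exists u; rewrite -Bu !mulmxDr !mulmxA eqX1 eqX2 eqX3 !mulmxDl.
by apply/colP => i; rewrite ![fun_of_matrix (_ + _) _ _]mxE; ring.
Qed.

(** The two [B] terms differ by some [Q_S *m d], and [d] serves as fourth block of a kernel vector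
    of the injective [M]. *)
Let mod_unique a b c u a' b' c' u' :
  U_S *m a + R_S *m b + O_S *m c + B *m u =
  U_S *m a' + R_S *m b' + O_S *m c' + B *m u' :> 'cV_l ->
  [/\ a = a', b = b' & c = c'].
Proof.
have /imP[d eqd] : B *m (u - u') \in im Q_S by rewrite im_Q_S mem_im.
move=> eqab; have : M *m col_mx (col_mx (col_mx (a - a') (b - b')) (c - c')) d = 0.
  move/eqP: eqab; rewrite -subr_eq0 => /eqP <-; rewrite !mul_row_col -eqd !mulmxBr.
  by apply/colP => i; rewrite !opprD ![fun_of_matrix (_ + _) _ _]mxE
    ![fun_of_matrix (- _) _ _]mxE; ring.
move/injS/eqP; rewrite !col_mx_eq0 !subr_eq0.
by case/andP => /andP[/andP[/eqP-> /eqP->] /eqP->].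
Qed.

Let M_full : row_full M.
Proof. by apply/eqP/mul_inj_rank. Qed.

(** Triangularity determines [N'] up to a term [Q_S *m X], whatever the feedback [G]; the condition
    on the last [m2] rows says exactly [X = 0]. *)
Lemma triangular_mod_block N N11 N12 N13 N22 N23 N33 (G : 'M_(m, n1 + n2 + n3)) :
  triangular_mod N N11 N12 N13 N22 N23 N33 ->
  let N' := N *m row_mx (row_mx U_T R_T) O_T + B *m G in
  0 = row_mx 0 1%:M *m pinvmx M *m N' ->
  pinvmx M *m N' =
    col_mx (col_mx (col_mx
      (row_mx (row_mx N11 N12) N13)
      (row_mx (row_mx 0 N22) N23))
      (row_mx (row_mx 0 0) N33))
      0.
Proof.
move=> triN N'; set D := col_mx _ (row_mx _ N33).
have [X eqX] : exists X, N' - M *m col_mx D 0 = Q_S *m X.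
  apply: im_factor => x; rewrite im_Q_S -[x]vsubmxK -[usubmx x]vsubmxK.
  set a := usubmx (usubmx x); set b := dsubmx (usubmx x); set c := dsubmx x.
  have [u] := triN a b c; rewrite !mulmxDr => equ.
  apply/imP; exists (u + G *m col_mx (col_mx a b) c).
  rewrite mulmxBl mulmxDl -!mulmxA /D !(mul_row_col, mul_col_mx, mul0mx, mulmx0) !mulmxDr.
  rewrite equ !(mulmx0, add0r, addr0).
  by apply/colP => i; rewrite !opprD ![fun_of_matrix (_ + _) _ _]mxE
    ![fun_of_matrix (- _) _ _]mxE; ring.
have -> : N' = M *m col_mx D X.
  rewrite -[N'](subrK (M *m col_mx D 0)) eqX !mul_row_col mulmx0 addr0.
  by rewrite addrC.
rewrite -mulmxA !(mulmxA (pinvmx M)) mulVpmx // !mul1mx mul_row_col mul0mx add0r mul1mx.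
by move=> <-.
Qed.

Lemma pinvmx_mul_Q_S : pinvmx M *m Q_S = col_mx 0 1%:M.
Proof.
have {1}-> : Q_S = M *m col_mx 0 1%:M by rewrite mul_row_col mulmx0 add0r mulmx1.
by rewrite mulmxA mulVpmx // mul1mx.
Qed.

Variables (E11 A11 : 'M[F]_(l1, n1)) (E12 A12 : 'M[F]_(l1, n2)).
Variables (E13 A13 : 'M[F]_(l1, n3)) (E22 A22 : 'M[F]_(l2, n2)).
Variables (E23 A23 : 'M[F]_(l2, n3)) (E33 A33 : 'M[F]_(l3, n3)).
Hypothesis triE : triangular_mod E E11 E12 E13 E22 E23 E33.
Hypothesis triA : triangular_mod A A11 A12 A13 A22 A23 A33.

Let E_U a : exists u, E *m (U_T *m a) = U_S *m (E11 *m a) + B *m u :> 'cV_l.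
Proof.
by have [u] := triE a 0 0; rewrite !(mulmx0, addr0) => eqE; exists u.
Qed.

Let A_U a : exists u, A *m (U_T *m a) = U_S *m (A11 *m a) + B *m u :> 'cV_l.
Proof.
by have [u] := triA a 0 0; rewrite !(mulmx0, addr0) => eqA; exists u.
Qed.

(** [U_S *m y] lies in [E (Vs :&: Ws) + im B]; comparing coordinates modulo [im B] makes [E11]
    surjective. *)
Lemma rank_E11 : \rank E11 = l1.
Proof.
apply: mul_surj_rank => y; have : U_S *m y \in (im U_S + im Q_S)%VS.
  by apply: (subvP (addvSl _ _)); apply: mem_im.
rewrite im_U_S => /mem_img_add_im[v]; rewrite -im_U_T => /imP[a ->] [u].
have [u' ->] := E_U a => eqy; exists a.
case: (@mod_unique y 0 0 0 (E11 *m a) 0 0 (u' + u)) => //.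
by rewrite !(mulmx0, addr0) eqy [B *m (_ + _)]mulmxDr addrA.
Qed.

Lemma wongW_step11 i a : U_T *m a \in wongW E A B i.+1 ->
  exists2 a', U_T *m a' \in wongW E A B i & E11 *m a = A11 *m a' :> 'cV_l1.
Proof.
move=> aW; have [w /memv_capP[wV wW] [u eqE]] := wongW_step (U_T_V a) aW.
have : w \in (Vs :&: Ws)%VS by apply: wongW_mem_cap wW.
rewrite -im_U_T => /imP[a' eqw]; exists a'; rewrite -?eqw //.
move: eqE; rewrite eqw; have [u1 ->] := E_U a; have [u2 ->] := A_U a' => eqE.
case: (@mod_unique (E11 *m a) 0 0 u1 (A11 *m a') 0 0 (u2 + u)) => //.
by rewrite !(mulmx0, addr0) eqE mulmxDr addrA.
Qed.

Lemma U_T_wongW a : exists i, U_T *m a \in wongW E A B i.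
Proof. by have /memv_capP[_ /mem_wongWlim] := U_T_K a. Qed.

Lemma l1_lt_n1 : (l1 < n1)%N \/ l1 = 0%N /\ n1 = 0%N.
Proof.
have rE := rank_E11; have := rank_leq_col E11; rewrite rE leq_eqVlt.
case/orP => [/eqP l1n1|]; [right|by left].
suff n10 : n1 = 0%N by rewrite l1n1.
(* In the square case [E11] is injective, so by induction each [wongW E A B i] meets [Vs :&: Ws]
   only in 0. *)
have a0 i (a : 'cV_n1) : U_T *m a \in wongW E A B i -> a = 0.
  elim: i a => [|i IHi] a.
    rewrite memv0 => /eqP Ua0.
    by have [] := @injT a 0 0; rewrite // !(mulmx0, addr0).
  move=> /wongW_step11[a' /IHi-> ]; rewrite mulmx0.
  by apply: rank_mul_inj; rewrite rE.
(* [n1] is the rank of the identity, which is 0 once every column vector is 0. *)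
rewrite -(mxrank1 F n1) (_ : 1%:M = 0) ?mxrank0 //; apply: mulmx_cV_eq0 => a.
by have [i /a0->] := U_T_wongW a; rewrite mulmx0.
Qed.

(* If [y *m (lambda E11 - A11) = 0] then [y *m E11] vanishes on the coordinates
   of [V* :&: W_i], by induction on [i]: [E11 a = A11 a'] with [a'] of level
   [i - 1] gives [y *m E11 *m a = lambda *: (y *m E11 *m a')]. *)
Lemma rank_pencil11 (K : fieldType) (f : {rmorphism F -> K}) lambda :
  \rank (lambda *: map_mx f E11 - map_mx f A11) = l1.
Proof.
apply/eqP/inj_row_free => y; rewrite mulmxBr -scalemxAr => /eqP.
rewrite subr_eq0 => /eqP eqy.
have yE0 i (a : 'cV_n1) : U_T *m a \in wongW E A B i ->
    y *m map_mx f E11 *m map_mx f a = 0.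
  elim: i a => [|i IHi] a.
    rewrite memv0 => /eqP Ua0.
    have [] := @injT a 0 0; rewrite ?Ua0 ?(mulmx0, addr0) // => -> _ _.
    by rewrite map_mx0 mulmx0.
  move=> /wongW_step11[a' /IHi IHa eqa].
  by rewrite -mulmxA -map_mxM eqa map_mxM mulmxA -eqy -scalemxAl IHa scaler0.
have yE : y *m map_mx f E11 = 0.
  apply/rowP => j; have [i /yE0] := U_T_wongW (delta_mx j 0).
  by rewrite map_delta_mx -colE => /matrixP/(_ 0 0); rewrite !mxE.
have free : row_free (map_mx f E11) by rewrite row_free_map /row_free rank_E11.
by apply: (row_free_inj free); rewrite yE mul0mx.
Qed.

Lemma rank_E22 : \rank E22 = l2 /\ \rank E22 = n2.
Proof.
split; [apply: mul_surj_rank => y|apply: mul_inj_rank => b E22b].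
  have : R_S *m y \in (im R_S + im U_S + im Q_S)%VS.
    by rewrite -addvA; apply: (subvP (addvSl _ _)); apply: mem_im.
  rewrite im_R_S => /mem_img_add_im[_ /V_P[a [b ->]] [u]].
  have [u'] := triE a b 0; rewrite !(mulmx0, addr0) => -> eqy; exists b.
  case: (@mod_unique 0 y 0 0 (E11 *m a + E12 *m b) (E22 *m b) 0 (u' + u)) => //.
  by rewrite !(mulmx0, add0r, addr0) eqy [B *m (_ + _)]mulmxDr addrA.
(* With [E22 *m b = 0], modulo [im B] only [U_S *m (E12 *m b)] remains of [E *m (R_T *m b)]. It lies
   in [E (Vs :&: Ws) + im B], so [R_T *m b] falls into [im U_T], against directness unless
   [b = 0]. *)
have [u'] := triE 0 b 0; rewrite !(mulmx0, E22b, add0r, addr0) => eqE.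
have : U_S *m (E12 *m b) \in (im U_S + im Q_S)%VS.
  by apply: (subvP (addvSl _ _)); apply: mem_im.
rewrite im_U_S => /mem_img_add_im[v vK [u eqU]].
have : R_T *m b \in (Vs :&: Ws)%VS.
  apply: (@wong_cap_mod _ _ _ _ E A B (R_T *m b) v (u + u')) => //.
    by apply/V_P; exists 0, b; rewrite mulmx0 add0r.
  by rewrite eqE eqU mulmxDr addrA.
rewrite -im_U_T => /imP[a eqa].
case: (@injT a (- b) 0) => [|_ /eqP]; last by rewrite oppr_eq0 => /eqP.
by rewrite mulmx0 addr0 mulmxN eqa subrr.
Qed.

(* A nonzero [Y] with [A33 Y = E33 Y L] would enlarge [V*], the largest
   subspace [X] with [A X <= E X + im B]. *)
Lemma no_invariant33 k (Y : 'M_(n3, k)) (L : 'M_k) :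
  A33 *m Y = E33 *m Y *m L -> Y = 0.
Proof.
move=> eqY; pose X := (im (O_T *m Y) + Vs)%VS.
have XV : (X <= Vs)%VS.
  apply: wongVlim_max => _ /memv_addP[_ /imP[y ->] [v vV ->]].
  have [v' v'V [u eqv]] := elimT (wongVlimP _ _ _ _) vV.
  (* [A] at [Y y] and [E] at [Y (L y)] have the same [O_S] component [e]; the remaining difference
     [g - f] lies in [E Vs + im B]. *)
  have [u1] := triA 0 0 (Y *m y); have [u2] := triE 0 0 (Y *m (L *m y)).
  have -> : A33 *m (Y *m y) = E33 *m (Y *m (L *m y)) by rewrite !mulmxA eqY.
  rewrite !(mulmx0, add0r); set e := O_S *m _ => eqE eqA.
  set f := U_S *m _ + R_S *m _ in eqE; set g := U_S *m _ + R_S *m _ in eqA.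
  have : g - f \in (im R_S + im U_S + im Q_S)%VS.
    apply: (subvP (addvSl _ _)); rewrite [(im R_S + _)%VS]addvC.
    by rewrite memvB // /f /g memv_add ?mem_im.
  rewrite im_R_S => /mem_img_add_im[v2 v2V [u3 eqgf]].
  exists (O_T *m Y *m (L *m y) + (v2 + v')).
    by rewrite memv_add ?mem_im // memvD.
  exists (u1 - u2 + u3 + u); rewrite !mulmxDr mulmxN -!(mulmxA O_T).
  rewrite eqv eqA eqE -[g](subrK f) eqgf.
  by apply/colP => i; rewrite ![fun_of_matrix (_ + _) _ _]mxE
    ![fun_of_matrix (- _) _ _]mxE; ring.
(* Now [im (O_T *m Y)] lies in [Vs = im U_T + im R_T], so injectivity of [T] gives [Y y = 0]. *)
apply: mulmx_cV_eq0 => y; have : O_T *m (Y *m y) \in Vs.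
  by apply: (subvP XV); apply: (subvP (addvSl _ _)); rewrite mulmxA mem_im.
case/V_P => a [b eqOY]; case: (@injT (- a) (- b) (Y *m y)) => //.
by rewrite eqOY !mulmxN -opprD addNr.
Qed.

End TriangularBlocks.

(** * From complex kernel vectors to real invariant subspaces *)

Section ComplexPencil.
Set Implicit Arguments.
Unset Strict Implicit.
Variable R : realType.

Lemma Re_real_mulmx p q (M : 'M[R]_(p, q)) (z : 'cV[R[i]]_q) i :
  complex.Re ((map_mx (real_complex R) M *m z) i 0) =
  (M *m map_mx (@complex.Re R) z) i 0.
Proof.
rewrite !mxE (big_morph (@complex.Re R) (id1 := 0) (op1 := +%R)) => [|[? ?] [? ?]|] //.
by apply: eq_bigr => j _; rewrite !mxE; case: (z j 0) => a b /=; rewrite mul0r subr0.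
Qed.

Lemma Im_real_mulmx p q (M : 'M[R]_(p, q)) (z : 'cV[R[i]]_q) i :
  complex.Im ((map_mx (real_complex R) M *m z) i 0) =
  (M *m map_mx (@complex.Im R) z) i 0.
Proof.
rewrite !mxE (big_morph (@complex.Im R) (id1 := 0) (op1 := +%R)) => [|[? ?] [? ?]|] //.
by apply: eq_bigr => j _; rewrite !mxE; case: (z j 0) => a b /=; rewrite mul0r addr0.
Qed.

(* The real and imaginary parts of a kernel vector of [lambda E - A] span a
   subspace on which [A] acts as [E] after a real endomorphism [L]. *)
Lemma rank_pencilC_inj p q (E A : 'M[R]_(p, q)) :
  (forall k (Y : 'M_(q, k)) (L : 'M_k), A *m Y = E *m Y *m L -> Y = 0) ->
  forall lambda, \rank (pencilC E A lambda) = q.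
Proof.
move=> noinv [a b]; apply: mul_inj_rank => z; rewrite /pencilC mulmxBl -scalemxAl.
move/eqP; rewrite subr_eq0 => /eqP eqz.
pose r := map_mx (@complex.Re R) z; pose s := map_mx (@complex.Im R) z.
(* Real and imaginary parts of [A z = (a + i b) E z] for [z = r + i s]. *)
have Ar : A *m r = a *: (E *m r) - b *: (E *m s).
  apply/colP => i; have /colP/(_ i)/(congr1 (@complex.Re R)) := eqz.
  rewrite Re_real_mulmx => <-; rewrite [in LHS]mxE [RHS]mxE [in X in _ = _ + X]mxE.
  rewrite ![fun_of_matrix (_ *: _) _ _]mxE -Re_real_mulmx -Im_real_mulmx.
  by case: (_ i 0).
have As : A *m s = b *: (E *m r) + a *: (E *m s).
  apply/colP => i; have /colP/(_ i)/(congr1 (@complex.Im R)) := eqz.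
  rewrite Im_real_mulmx => <-; rewrite [in LHS]mxE [RHS]mxE.
  rewrite ![fun_of_matrix (_ *: _) _ _]mxE -Re_real_mulmx -Im_real_mulmx.
  by case: (_ i 0) => x y /=; rewrite addrC.
have /eqP : row_mx r s = 0.
  (* The block columns of [L] are the coefficients of [r] and [s] in [Ar] and in [As]. *)
  apply: (noinv _ _ (block_mx a%:M b%:M (- b)%:M a%:M)).
  rewrite -mulmxA mul_row_block !mul_mx_row !mul_mx_scalar !mulmxDr Ar As.
  by rewrite -!scalemxAr scaleNr.
rewrite row_mx_eq0 => /andP[/eqP/colP r0 /eqP/colP s0].
apply/colP => i; have := r0 i; have := s0 i; rewrite !mxE.
by case: (z i 0) => x y /= -> ->.
Qed.

End ComplexPencil.

(* pinvmx is the two-sided inverse of a row-free and row-full matrix; unlike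
   invmx it does not require the two dimensions to be syntactically equal. *)
Theorem theorem4p12 (R : realType) (l n m : nat)
    (E A : 'M[R]_(l, n)) (B : 'M[R]_(l, m))
    (n1 n2 n3 l1 l2 l3 m1 m2 : nat)
    (U_T : 'M[R]_(n, n1)) (R_T : 'M[R]_(n, n2)) (O_T : 'M[R]_(n, n3))
    (Q_S : 'M[R]_(l, m2)) (U_S : 'M[R]_(l, l1)) (R_S : 'M[R]_(l, l2))
    (O_S : 'M[R]_(l, l3))
    (F_P F_D : 'M[R]_(m, n1 + n2 + n3))
    (V1 : 'M[R]_(m, m1)) (V2 : 'M[R]_(m, m2)) :
  let Vs := wongVlim E A B in
  let Ws := wongWlim E A B in
  let T := row_mx (row_mx U_T R_T) O_T in
  let S := pinvmx (row_mx (row_mx (row_mx U_S R_S) O_S) Q_S) in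
  let V := row_mx V1 V2 in
  let P2 : 'M[R]_(m2, l1 + l2 + l3 + m2) := row_mx 0 1%:M in
  [/\ \rank U_T = n1, \rank R_T = n2 & \rank O_T = n3] ->
  [/\ \rank Q_S = m2, \rank U_S = l1, \rank R_S = l2 & \rank O_S = l3] ->
  im U_T = (Vs :&: Ws)%VS ->
  directv (im R_T + im U_T) -> (im R_T + im U_T)%VS = Vs ->
  directv (im O_T + im R_T + im U_T) ->
  (im O_T + im R_T + im U_T)%VS = fullv ->
  im Q_S = im B ->
  directv (im U_S + im Q_S) ->
  (im U_S + im Q_S)%VS = (mxfun E @: (Vs :&: Ws) + im B)%VS ->
  directv (im R_S + im U_S + im Q_S) ->
  (im R_S + im U_S + im Q_S)%VS = (mxfun E @: Vs + im B)%VS ->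
  directv (im O_S + im R_S + im U_S + im Q_S) ->
  (im O_S + im R_S + im U_S + im Q_S)%VS = fullv ->
  0 = P2 *m S *m (E *m T + B *m F_D) ->
  0 = P2 *m S *m (A *m T + B *m F_P) ->
  \rank V1 = m1 -> \rank V2 = m2 ->
  im V1 = ker B ->
  directv (im V1 + im V2) -> (im V1 + im V2)%VS = fullv ->
  qpdff (S *m (E *m T + B *m F_D)) (S *m (A *m T + B *m F_P)) (S *m B *m V).
Proof.
move=> Vs Ws T S V P2 [rUT rRT rOT] [rQS rUS rRS rOS] imUT dirV imV dirT _ imQS.
move=> dirUS imUS dirRS imRS dirS imOS P2E P2A rV1 rV2 imV1 dirV12 _.
have injT (a : 'cV_n1) (b : 'cV_n2) (c : 'cV_n3) :
    U_T *m a + R_T *m b + O_T *m c = 0 -> [/\ a = 0, b = 0 & c = 0].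
  move: dirT; rewrite directv_addE directv_addE /= => /and3P[/and3P[_ _ OR] _ ORU].
  (* The terms are reordered to match the nesting [(im O_T + im R_T) + im U_T], then peeled off from
     the right. *)
  rewrite addrC addrA addrAC => e.
  have [||{}e] := capv0_add_eq0 ORU e; rewrite ?memv_add ?mem_im //.
  have [||] := capv0_add_eq0 OR e; rewrite ?mem_im //.
  by move=> /(rank_mul_inj rOT)-> /(rank_mul_inj rRT)-> /(rank_mul_inj rUT)->.
have injS (x : 'cV_(l1 + l2 + l3 + m2)) :
    row_mx (row_mx (row_mx U_S R_S) O_S) Q_S *m x = 0 -> x = 0.
  move: dirS; rewrite !directv_addE /= => /and3P[/and3P[/and3P[_ _ OR] _ ORU] _ ORUQ].
  rewrite -[x]vsubmxK -[usubmx x]vsubmxK -[usubmx (usubmx x)]vsubmxK !mul_row_col.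
  rewrite [U_S *m _ + _ + _]addrC addrA addrAC => e.
  have [||{}e] := capv0_add_eq0 ORUQ e; rewrite ?memv_add ?mem_im //.
  have [||{}e] := capv0_add_eq0 ORU e; rewrite ?memv_add ?mem_im //.
  have [||] := capv0_add_eq0 OR e; rewrite ?mem_im //.
  move=> /(rank_mul_inj rOS)-> /(rank_mul_inj rRS)-> /(rank_mul_inj rUS)->.
  by move=> /(rank_mul_inj rQS)->; rewrite !col_mx0.
have EV_im (X : {vspace 'cV[R]_n}) x : x \in X -> E *m x \in (mxfun E @: X + im B)%VS.
  by move=> xX; apply/mem_img_add_im; exists x => //; exists 0; rewrite mulmx0 addr0.
have U_T_K a : U_T *m a \in (Vs :&: Ws)%VS by rewrite -imUT mem_im.
have R_T_V b : R_T *m b \in Vs.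
  by rewrite -imV; apply: (subvP (addvSl _ _)); apply: mem_im.
have [||E11 [E12 [E13 [E22 [E23 [E33 triE]]]]]] :=
  triangular_mod_exists (U_T := U_T) (R_T := R_T) O_T imQS imOS (N := E).
- by move=> a; rewrite imUS EV_im.
- by move=> b; rewrite imRS EV_im.
have [||A11 [A12 [A13 [A22 [A23 [A33 triA]]]]]] :=
  triangular_mod_exists (U_T := U_T) (R_T := R_T) O_T imQS imOS (N := A).
- by move=> a; rewrite imUS; apply/mem_img_add_im/wong_cap_inv.
- by move=> b; rewrite imRS; apply/mem_img_add_im/wongVlimP.
(* [Bhat] holds the coordinates of [B *m V2] in the basis [Q_S] of [im B]. *)
have [Bhat eqB] : exists X, B *m V2 = Q_S *m X.
  by apply: im_factor => x; rewrite imQS -mulmxA mem_im.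
have BV1 : B *m V1 = 0.
  by apply: mulmx_cV_eq0 => x; rewrite -mulmxA; apply/kerP; rewrite -imV1 mem_im.
(* A kernel vector [x] of [Bhat] gives [V2 *m x] in [ker B = im V1], which meets [im V2]
   trivially. *)
have Bhat_unit : Bhat \in unitmx.
  have rBhat : \rank Bhat = m2.
    apply: mul_inj_rank => x Bx0; apply: (rank_mul_inj rV2).
    have : V2 *m x \in im V1.
      by rewrite imV1; apply/kerP; rewrite mulmxA eqB -mulmxA Bx0 mulmx0.
    move: dirV12 => /directv_addP V120 V2x; apply/eqP.
    by rewrite -memv0 -V120 memv_cap V2x mem_im.
  by rewrite -row_free_unit /row_free rBhat.
have SBV : S *m B *m V =
    col_mx (col_mx (col_mx (row_mx 0 0) (row_mx 0 0)) (row_mx 0 0)) (row_mx 0 Bhat).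
  rewrite -mulmxA mul_mx_row BV1 eqB mul_mx_row mulmx0 mulmxA pinvmx_mul_Q_S //.
  rewrite mul_col_mx mul0mx mul1mx !row_mx0 !col_mx0.
  (* The same 2 by 2 block matrix is read first by columns, then by rows. *)
  by rewrite -[0 in LHS]col_mx0 -block_mxEh block_mxEv row_mx0.
exists E11, A11, E12, A12, E13, A13, E22, A22, E23, A23, E33, A33, Bhat.
have [r2 r2'] := rank_E22 injT injS imUT imV imQS imUS imRS triE.
split; [split|split|exact: rank_castmx_unit|idtac|split=> //].
- exact: triangular_mod_block.
- exact: triangular_mod_block.
- exact: SBV.
- exact: (l1_lt_n1 injT injS imUT imQS imUS triE triA).
- exact: (rank_E11 injS imUT imQS imUS triE).
- exact: (rank_pencil11 injT injS imUT imQS imUS triE triA).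
- apply: rank_pencilC_inj => k Y L.
  exact: (no_invariant33 injT imV imRS triE triA).
(* The rank required to be [m2] is that of [S *m B *m V], read off its only nonzero block [Bhat]. *)
by rewrite SBV !row_mx0 !col_mx0 rank_col_0mx rank_row_0mx mxrank_unit.
Qed.
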